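(* Let $n\geq 2$ and $r\geq 3$ be integers, and let $S_1,S_r>0$ satisfy $S_r\leq S_1^r\leq n^{r-1}S_r$. Define $\tilde n\geq 1$ by $\tilde n^{\,r-1}=S_1^rS_r^{-1}$. Let $x_1,\dots,x_n\geq 0$ be real numbers with $x_1+\cdots+x_n=S_1$ and $x_1^r+\cdots+x_n^r=S_r$, and let $E=\sum_{1\leq i<j\leq n}(x_i-x_j)^2$. Then \[ E\leq \frac{S_1^2}{\lceil\tilde n\rceil}\Bigl(n(\lceil\tilde n\rceil-1)\alpha^2+n-\lceil\tilde n\rceil\Bigr), \] where $\alpha$ is the root in $\left(-\frac{1}{\lceil\tilde n\rceil-1},0\right)$ of \[ (1+\alpha(\lceil\tilde n\rceil-1))^r+(\lceil\tilde n\rceil-1)(1-\alpha)^r=\lceil\tilde n\rceil^rS_rS_1^{-r}. \]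
   Context: $E$ is called the potential energy of $x_1,\dots,x_n$; $\lceil\cdot\rceil$ denotes the ceiling function.
   Formalization: If ñ is an integer ≥ 2 there is no root in the open interval (the root is α = 0), so the bound is proved for roots in (−1/(⌈ñ⌉−1), 0], with left end −∞ when ñ = 1; existence and uniqueness of the root in the open interval are proved for non-integer ñ. *)

(* Defs.v *)
From HB Require Import structures.
From mathcomp Require Import all_boot all_order all_algebra.
From mathcomp Require Import reals.

Set Implicit Arguments.
Unset Strict Implicit.
Unset Printing Implicit Defensive.

Import Order.TTheory GRing.Theory Num.Theory.
Local Open Scope ring_scope.

Definition potential_energy (R : realType) (n : nat) (x : 'I_n -> R) : R :=
  \sum_(i < n) \sum_(j < n | (i < j)%N) (x i - x j) ^+ 2.

Definition alpha_eq (R : realType) (r : nat) (m S1 Sr alpha : R) : Prop :=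
  (1 + alpha * (m - 1)) ^+ r + (m - 1) * (1 - alpha) ^+ r
    = m ^+ r * Sr * S1 ^- r.

(* The bound - 1 / (m - 1) < alpha, read as - oo < alpha when m = 1; without
   the guard, the convention 1 / 0 = 0 would turn it into 0 < alpha. *)
Definition above_left_end (R : realType) (m alpha : R) : Prop :=
  1 < m -> - (1 / (m - 1)) < alpha.

(* Main.v *)
(* Since E = n S_2 - S_1^2 with S_2 = \sum x_i^2, the task is to bound S_2 given
   the sum and the sum of r-th powers. The extremal point consists of m - 1
   copies of b = (S1 / m) (1 - alpha), one a = (S1 / m) (1 + alpha (m - 1)) <= b,
   and zeros. Take g(t) = P t^r - A t^2 - B t with A > 0: the terms in P and B
   have the same sum at x and at the extremal point, so it is enough that
   \sum g(x_i) >= (m - 1) g(b) + g(a). With P = 1 and g' vanishing at u < b,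
   where u is the m-th or the (m-1)-st largest x_i, convexity of t^(r-1) makes g
   increase on [0, u], decrease on [u, b] and increase on [b, +oo), and the
   inequality holds term by term after sorting. *)

Require Import Defs.
From HB Require Import structures.
From mathcomp Require Import all_boot all_order all_algebra.
From mathcomp Require Import reals.
From mathcomp Require Import zify ring lra.
From mathcomp Require Import polyrcf.

Set Implicit Arguments.
Unset Strict Implicit.
Unset Printing Implicit Defensive.

Import Order.TTheory GRing.Theory Num.Theory.
Local Open Scope ring_scope.

(** * Test functions: a power minus a quadratic *)

(** The quotient [q] is the complete homogeneous polynomial of degree [p - 2] in [t], [u], [b], and
    [c] is the one of degree [p - 1] in [u], [b]; their recursions in the degree drive the
    induction. *)
Lemma expr_sub_chord (R : realFieldType) (p : nat) (u b : R) :
  0 <= u -> 0 <= b ->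
  exists c d : R, [/\ 0 <= c, c * u + d = u ^+ p, c * b + d = b ^+ p &
    forall t, 0 <= t ->
      exists2 q, 0 <= q & t ^+ p - (c * t + d) = (t - u) * (t - b) * q].
Proof.
move=> u0 b0; elim: p => [|p [c [d [c0 cu cb IH]]]].
  exists 0, 1; split; rewrite ?expr0 ?mul0r ?add0r // => t _.
  by exists 0; rewrite // expr0 mulr0 mul0r add0r subrr.
exists (c * b + u ^+ p), (- (c * u * b)); split.
- by rewrite addr_ge0 ?mulr_ge0 ?exprn_ge0.
- by rewrite exprS -cu; ring.
- by rewrite exprS -cb -cu; ring.
move=> t t0; have [q q0 tE] := IH t t0; exists (q * t + c).
  by rewrite addr_ge0 ?mulr_ge0.
by rewrite exprS -[t ^+ p](subrK (c * t + d)) tE -cu; ring.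
Qed.

Lemma expr_sub_quadratic_mono (R : rcfType) (r : nat) (u b : R) :
  (2 <= r)%N -> 0 <= u -> u < b ->
  exists A B : R, 0 < A /\ let g t := t ^+ r - A * t ^+ 2 - B * t in
   [/\ forall s t, 0 <= s -> s <= t -> t <= u -> g s <= g t,
       forall s t, u <= s -> s <= t -> t <= b -> g t <= g s &
       forall s t, b <= s -> s <= t -> g s <= g t].
Proof.
case: r => [//|p]; rewrite ltnS => p0 u0 ub.
have b0 := le_lt_trans u0 ub.
have [c [d [_ cu cb dE]]] := expr_sub_chord p u0 (ltW b0).
have c0 : 0 < c.
  have : 0 < c * (b - u).
    rewrite (_ : _ * _ = b ^+ p - u ^+ p); last by rewrite -cu -cb; ring.
    by rewrite subr_gt0 ltr_pXn2r // ?nnegrE // ltW.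
  by rewrite pmulr_lgt0 // subr_gt0.
set k : R := p.+1%:R; have k0 : 0 < k by rewrite ltr0n.
(* With these values [g'] is [r] times [t ^+ p - (c * t + d)], so its sign on [t >= 0] is that of
   [(t - u) * (t - b)], or it is zero. *)
exists (k * c / 2), (k * d); split; first by rewrite divr_gt0 ?mulr_gt0.
pose G : {poly R} := 'X^(p.+1) - (k * c / 2) *: 'X^2 - (k * d) *: 'X.
have GE t : G.[t] = t ^+ p.+1 - (k * c / 2) * t ^+ 2 - (k * d) * t.
  by rewrite /G !hornerE.
have G'E t : 0 <= t -> exists2 q, 0 <= q & G^`().[t] = (t - u) * (t - b) * q.
  move=> /dE[q q0 qE]; exists (k * q); first by rewrite mulr_ge0 // ltW.
  rewrite mulrCA -qE /G !derivE /= !hornerE hornerMn hornerXn -mulr_natl -/k.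
  by field.
have mvt s t : s <= t -> exists2 z, s <= z <= t &
    G.[t] - G.[s] = G^`().[z] * (t - s).
  rewrite le_eqVlt => /predU1P[<-|/(poly_mvt G)[z zst ->]].
    by exists s; rewrite ?lexx // !subrr mulr0.
  by exists z => //; rewrite !(itvP zst).
move=> g; have gE t : g t = G.[t] by rewrite GE.
split=> s t st1 st2 => [tu|tb|]; rewrite !gE -subr_ge0.
- have [//|z /andP[sz zt] ->] := mvt s t.
  have [|q q0 ->] := G'E z; first lra.
  by rewrite mulr_ge0 ?subr_ge0 // mulr_ge0 // mulr_le0 // subr_le0; lra.
- have [//|z /andP[sz zt]] := mvt s t; rewrite -(opprB G.[s]) => /eqP.
  rewrite eqr_oppLR => /eqP ->.
  have [|q q0 ->] := G'E z; first lra.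
  rewrite oppr_ge0 mulr_le0_ge0 ?subr_ge0 // mulr_le0_ge0 //.
  by rewrite mulr_ge0_le0 //; lra.
- have [//|z /andP[sz zt] ->] := mvt s t.
  have [|q q0 ->] := G'E z; first lra.
  by rewrite mulr_ge0 ?subr_ge0 // mulr_ge0 // mulr_ge0 // subr_ge0; lra.
Qed.


(** * Comparison with the extremal point *)

Lemma ler_sum_const_seq (R : numDomainType) (s : seq R) (g : R -> R) (c : R) :
  {in s, forall z, c <= g z} -> (size s)%:R * c <= \sum_(z <- s) g z.
Proof.
move=> gc; rewrite -sum1_size natr_sum mulr_suml !big_seq.
by apply: ler_sum => z /gc; rewrite mul1r.
Qed.

Section ExtremalConfiguration.
Variables (R : rcfType) (r : nat) (a b v : R) (s1 s2 : seq R).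
Let x := s1 ++ v :: s2.
Hypothesis sum1 : \sum_(z <- x) z = (size s1)%:R * b + a.
Hypothesis sumr : \sum_(z <- x) z ^+ r = (size s1)%:R * b ^+ r + a ^+ r.

(** Each entry of [s1] is matched with [b], [v] with [a], and each entry of [s2] with 0, where [g]
    vanishes. Summing cancels the terms in [P] and [B]. *)
Lemma sum_sqr_le_of_test (P A B : R) : (0 < r)%N -> 0 < A ->
  let g t := P * t ^+ r - A * t ^+ 2 - B * t in
  {in s1, forall z, g b <= g z} -> g a <= g v ->
  {in s2, forall z, 0 <= g z} ->
  \sum_(z <- x) z ^+ 2 <= (size s1)%:R * b ^+ 2 + a ^+ 2.
Proof.
move=> r0 A0 g g1 gv g2.
have : (size s1)%:R * g b + g a <= \sum_(z <- x) g z.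
  rewrite big_cat big_cons /=; apply: lerD; first exact: ler_sum_const_seq.
  by apply: ler_wpDr; rewrite // big_seq sumr_ge0.
rewrite !sumrB -!mulr_sumr sum1 sumr /g => H; rewrite -(ler_pM2l A0); lra.
Qed.

Lemma sum_sqr_le_extremal : (2 <= r)%N -> 0 <= a -> a <= b ->
  sorted >=%R x -> {in x, forall z, 0 <= z} ->
  \sum_(z <- x) z ^+ 2 <= (size s1)%:R * b ^+ 2 + a ^+ 2.
Proof.
move=> r2 a0 ab; have r0 : (0 < r)%N by exact: ltnW.
have b0 := le_trans a0 ab.
rewrite sorted_pairwise; last exact: ge_trans.
rewrite pairwise_cat /= allrel_consr.
move=> /andP[/andP[/allP s1v /allrelP s12] /and3P[s1p /allP vs2 _]] x0.
have v0 : 0 <= v by rewrite x0 // mem_cat inE eqxx orbT.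
have s20 z : z \in s2 -> 0 <= z.
  by move=> zs; rewrite x0 // mem_cat inE zs !orbT.
have [va|av] := ltP v a.
  (* Take [u = v]: the entries of [s1] lie in [[v, +oo)], where [g] is least at [b], and [a] lies in
     [[v, b]], where [g] decreases. *)
  have [A [B [A0 /=[up down up']]]] :=
    expr_sub_quadratic_mono r2 v0 (lt_le_trans va ab).
  apply: (@sum_sqr_le_of_test 1 A B) => //= [z zs1||z zs2]; rewrite ?mul1r.
  - have := s1v _ zs1; have [bz _|zb vz] := leP b z; first by rewrite up'.
    by rewrite down // ltW.
  - by rewrite down // ltW.
  - have := up 0 z (lexx _) (s20 _ zs2) (vs2 _ zs2).
    by rewrite !expr0n /= (gtn_eqF r0) !mulr0 !subr0.
have [s1b|] := boolP (all (>= b) s1).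
  (* Here x dominates the extremal point termwise. *)
  have zle z : z \in x -> z <= (size s1)%:R * b + a.
    move=> zx; rewrite -sum1 (big_rem z) //= lerDl big_seq sumr_ge0 // => y yx.
    by rewrite x0 // (mem_rem yx).
  have {}s1b z : z \in s1 -> b <= z by move/(allP s1b).
  (* The concave test [t * (S + b - t)] suffices: it is symmetric about [(S + b) / 2], so on
     [[b, S]] it is least at [b]. *)
  set S := _ + _ in zle.
  apply: (@sum_sqr_le_of_test 0 1 (- (S + b))) => //= [z zs1||z zs2].
  - have := s1b _ zs1; have := zle z; rewrite mem_cat zs1 => /(_ isT).
    move=> zS bz; rewrite -subr_ge0.
    have -> : 0 * z ^+ r - 1 * z ^+ 2 - - (S + b) * z -
      (0 * b ^+ r - 1 * b ^+ 2 - - (S + b) * b) = (z - b) * (S - z) by ring.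
    by rewrite mulr_ge0 ?subr_ge0.
  - have vS : v <= S by rewrite zle // mem_cat inE eqxx orbT.
    rewrite -subr_ge0.
    have -> : 0 * v ^+ r - 1 * v ^+ 2 - - (S + b) * v -
      (0 * a ^+ r - 1 * a ^+ 2 - - (S + b) * a) =
      (v - a) * ((S - v) + (b - a)) by ring.
    by rewrite mulr_ge0 ?subr_ge0 // addr_ge0 ?subr_ge0.
  - have zS : z <= S by rewrite zle // mem_cat inE zs2 !orbT.
    have -> : 0 * z ^+ r - 1 * z ^+ 2 - - (S + b) * z =
      z * ((S - z) + b) by ring.
    by apply: mulr_ge0; [exact: s20 | rewrite addr_ge0 ?subr_ge0].
move=> /allPn[y ys1]; rewrite -ltNge => yb.
(* Take [u = w], the last and smallest entry of [s1]. Now [a <= v <= w], so [a] and [v] are compared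
   where [g] increases. *)
have [w ws1 sw] : exists2 w, w \in s1 & {in s1, forall z, w <= z}.
  case: (lastP s1) s1p ys1 => [//|s w]; rewrite pairwise_rcons.
  move=> /andP[/allP sw _] _; exists w; first by rewrite mem_rcons inE eqxx.
  by move=> z; rewrite mem_rcons inE => /predU1P[->|/sw].
have vw := s1v _ ws1; have w0 := le_trans v0 vw.
have wb := le_lt_trans (sw _ ys1) yb.
have [A [B [A0 /=[up down up']]]] := expr_sub_quadratic_mono r2 w0 wb.
apply: (@sum_sqr_le_of_test 1 A B) => //= [z zs1||z zs2]; rewrite ?mul1r.
- have [bz|zb] := leP b z; first by rewrite up'.
  by rewrite down ?sw // ltW.
- by rewrite up.
- have := up 0 z (lexx _) (s20 _ zs2) (le_trans (vs2 _ zs2) vw).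
  by rewrite !expr0n /= (gtn_eqF r0) !mulr0 !subr0.
Qed.
End ExtremalConfiguration.

(** * The energy as a power sum *)

(** The sum over all ordered pairs counts each unordered pair twice, and its diagonal vanishes. *)
Lemma potential_energyE (R : realType) (n : nat) (x : 'I_n -> R) :
  potential_energy x = n%:R * (\sum_i x i ^+ 2) - (\sum_i x i) ^+ 2.
Proof.
have swap :
    potential_energy x =
      \sum_(i < n) \sum_(j < n | (j < i)%N) (x i - x j) ^+ 2.
  rewrite /potential_energy (exchange_big_dep xpredT) //=.
  by apply: eq_bigr => i _; apply: eq_bigr => j _; rewrite -sqrrN opprB.
have H : \sum_i \sum_j (x i - x j) ^+ 2 = potential_energy x *+ 2.
  rewrite mulr2n {2}swap -big_split; apply: eq_bigr => i _ /=.
  rewrite (bigID (fun j : 'I_n => (i < j)%N)) /=; congr +%R.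
  rewrite (bigID (fun j : 'I_n => j == i)) /= big1 => [|j /andP[_ /eqP->]];
    last by rewrite subrr expr0n.
  rewrite add0r; apply: eq_bigl => j.
  by rewrite -leqNgt ltn_neqAle andbC.
have : \sum_i \sum_j (x i - x j) ^+ 2 =
    (n%:R * (\sum_i x i ^+ 2) - (\sum_i x i) ^+ 2) *+ 2.
  under eq_bigr do under eq_bigr do rewrite sqrrB.
  under eq_bigr => i _.
    rewrite big_split sumrB /= sumr_const card_ord.
    rewrite sumrMnl -mulr_sumr; over.
  rewrite big_split sumrB /= sumr_const card_ord !sumrMnl -mulr_suml.
  rewrite -[X in X - _ + _]mulr_natl -[X in _ + X = _]mulr_natl; ring.
by rewrite H => /eqP; rewrite eqrMn2r => /eqP.
Qed.

(** * The equation for [alpha] *)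

(** The derivative at [c] has the sign of [(1 + c * (m - 1)) ^+ p - (1 - c) ^+ p], which is negative
    because [0 <= 1 + c * (m - 1) < 1 - c] for [c < 0] in the range. *)
Lemma alpha_fun_decr (R : rcfType) (r : nat) (m s t : R) :
  (2 <= r)%N -> 1 < m -> - (1 / (m - 1)) <= s -> s < t -> t <= 0 ->
  (1 + t * (m - 1)) ^+ r + (m - 1) * (1 - t) ^+ r <
    (1 + s * (m - 1)) ^+ r + (m - 1) * (1 - s) ^+ r.
Proof.
case: r => [//|p]; rewrite ltnS => p0 m1 ls st t0.
have k0 : 0 < m - 1 by rewrite subr_gt0.
pose G : {poly R} :=
  (1 + (m - 1) *: 'X) ^+ p.+1 + (m - 1) *: (1 - 'X) ^+ p.+1.
have GE z : G.[z] = (1 + z * (m - 1)) ^+ p.+1 + (m - 1) * (1 - z) ^+ p.+1.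
  by rewrite /G !hornerE mulrC.
rewrite -!GE -subr_lt0.
have [c /andP[]] := poly_mvt G st; rewrite !bnd_simp => sc ct ->.
rewrite pmulr_llt0 ?subr_gt0 //.
have -> : G^`().[c] =
    p.+1%:R * (m - 1) * ((1 + c * (m - 1)) ^+ p - (1 - c) ^+ p).
  rewrite /G derivD derivZ !deriv_exp !derivE /=.
  rewrite !(hornerE, hornerMn, horner_exp).
  by rewrite mulrnAr -mulrnDl -mulrA [RHS]mulr_natl -mulrDr mulN1r [_ * c]mulrC.
have c0 : c < 0 by exact: lt_le_trans t0.
have ca : 0 <= 1 + c * (m - 1).
  have : - (1 / (m - 1)) <= c by rewrite (le_trans ls) ?ltW.
  by rewrite lerNl ler_pdivlMr //; lra.
rewrite pmulr_rlt0 ?mulr_gt0 ?ltr0n // subr_lt0 ltr_pXn2r ?nnegrE //; nra.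
Qed.

(** Intermediate values: the bounds on [T] are the values of the left side at the two end points. *)
Lemma alpha_root_exists (R : rcfType) (r : nat) (m T : R) :
  (0 < r)%N -> 1 < m -> m < T -> T < m ^+ r / (m - 1) ^+ r.-1 ->
  exists alpha, [/\ - (1 / (m - 1)) < alpha, alpha < 0 &
    (1 + alpha * (m - 1)) ^+ r + (m - 1) * (1 - alpha) ^+ r = T].
Proof.
case: r => [//|p] _ m1 mT Tm; have k0 : 0 < m - 1 by rewrite subr_gt0.
pose G : {poly R} :=
  (1 + (m - 1) *: 'X) ^+ p.+1 + (m - 1) *: (1 - 'X) ^+ p.+1 - T%:P.
have GE z : G.[z] = (1 + z * (m - 1)) ^+ p.+1 + (m - 1) * (1 - z) ^+ p.+1 - T.
  by rewrite /G !hornerE mulrC.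
have l0 : - (1 / (m - 1)) <= 0 by rewrite oppr_le0 divr_ge0 // ltW.
have [|c /andP[]] := @poly_ivtoo _ G _ _ l0.
  rewrite pmulr_rlt0 !GE ?mul0r ?addr0 ?subr0 ?expr1n; first lra.
  have -> : 1 + - (1 / (m - 1)) * (m - 1) = 0 by field; rewrite gt_eqF.
  have -> : 1 - - (1 / (m - 1)) = m / (m - 1) by field; rewrite gt_eqF.
  rewrite expr0n add0r expr_div_n exprS [(m - 1) ^+ _]exprS subr_gt0.
  move: Tm; rewrite exprS; congr (_ < _).
  by field; rewrite expf_neq0 gt_eqF.
rewrite !bnd_simp => lc c0 /rootP; rewrite GE => /eqP; rewrite subr_eq0.
by move=> /eqP; exists c.
Qed.

(* When nt is an integer m >= 2, the equation has no root in the open interval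
   (- 1 / (m - 1), 0); its root is then the right end point alpha = 0, so the
   upper bound is stated over (- 1 / (m - 1), 0]. The first conjunct says that
   "the root" in the open interval is well defined for every other nt. *)
Theorem theorem1p4 (R : realType) (n r : nat) (hn : (2 <= n)%N) (hr : (3 <= r)%N)
    (S1 Sr : R) (hS1 : 0 < S1) (hSr : 0 < Sr)
    (hlow : Sr <= S1 ^+ r) (hup : S1 ^+ r <= n%:R ^+ r.-1 * Sr)
    (nt : R) (hnt1 : 1 <= nt) (hnt : nt ^+ r.-1 = S1 ^+ r * Sr^-1)
    (x : 'I_n -> R) (hx : forall i, 0 <= x i)
    (hsum1 : \sum_(i < n) x i = S1) (hsumr : \sum_(i < n) x i ^+ r = Sr) :
  let m : R := (Num.ceil nt)%:~R in
  (nt \isn't a Num.int ->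
     exists! alpha : R,
       [/\ above_left_end m alpha, alpha < 0 & alpha_eq r m S1 Sr alpha]) /\
  (forall alpha : R,
     above_left_end m alpha -> alpha <= 0 -> alpha_eq r m S1 Sr alpha ->
     potential_energy x
       <= S1 ^+ 2 / m * (n%:R * (m - 1) * alpha ^+ 2 + n%:R - m)).
Proof.
move=> m.
have rE : r = r.-1.+1 by rewrite prednK // (leq_trans _ hr).
have r2 : (2 <= r)%N by exact: ltnW.
have r0 : (0 < r)%N by exact: ltnW.
have [k kE] : exists k : nat, Num.ceil nt = k.+1%:Z.
  have : 0 < Num.ceil nt by rewrite ceil_gt0 (lt_le_trans ltr01).
  by case: (Num.ceil nt) => [[|k]|k] // _; exists k.
have mE : m = k.+1%:R by rewrite /m kE.
have m1E : m - 1 = k%:R by rewrite mE -natr1 addrK.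
have m0 : 0 < m by rewrite mE ltr0n.
have nt0 : 0 < nt by exact: lt_le_trans hnt1.
have ntr : Sr * S1 ^- r = (nt ^+ r.-1)^-1 by rewrite hnt invf_div.
(* [hup] says [nt <= n], hence [m <= n]; so [nth 0 s k] below is a true entry, not the default. *)
have kn : (k < n)%N.
  have : nt ^+ r.-1 <= n%:R ^+ r.-1 by rewrite hnt ler_pdivrMr.
  rewrite ler_pXn2r ?nnegrE ?(ltW nt0) // -?subn1 ?subn_gt0 //.
  rewrite (_ : n%:R = (Posz n)%:~R) // -ceil_le_int kE; lia.
split=> [ntN|alpha lalpha alpha0 alphaE].
  have /andP[mlt ntm] := ceil_itv nt.
  rewrite -/m intrB -/m in mlt ntm.
  have {}ntm : nt < m.
    rewrite lt_neqAle ntm andbT; apply: contraNneq ntN => ->.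
    by rewrite /m intr_int.
  have m1 : 1 < m by exact: le_lt_trans ntm.
  have k0 : 0 < m - 1 by rewrite subr_gt0.
  (* In this form the two bounds on the right side amount to [m - 1 < nt < m]. *)
  have TE : m ^+ r * Sr * S1 ^- r = m ^+ r / nt ^+ r.-1 by rewrite -mulrA ntr.
  have p0 : (0 < r.-1)%N by rewrite -subn1 subn_gt0.
  have mT : m < m ^+ r * Sr * S1 ^- r.
    rewrite TE {1}rE exprS -mulrA ltr_pMr // ltr_pdivlMr ?exprn_gt0 // mul1r.
    by rewrite ltr_pXn2r ?nnegrE // ltW.
  have Tm : m ^+ r * Sr * S1 ^- r < m ^+ r / (m - 1) ^+ r.-1.
    rewrite TE ltr_pM2l ?exprn_gt0 // ltf_pV2 ?posrE ?exprn_gt0 //.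
    by rewrite ltr_pXn2r ?nnegrE // ltW.
  have [al [lal al0 alE]] := alpha_root_exists r0 m1 mT Tm.
  exists al; split; first by split.
  move=> be [/(_ m1) lbe be0 beE]; apply/eqP; move: alE; rewrite -beE.
  have [albe|beal|//] := ltgtP al be.
  - have := alpha_fun_decr r2 m1 (ltW lal) albe (ltW be0).
    by move=> /lt_eqF + E; rewrite E eqxx.
  - have := alpha_fun_decr r2 m1 (ltW lbe) beal (ltW al0).
    by move=> /lt_eqF + E; rewrite E eqxx.
pose a := S1 / m * (1 + alpha * (m - 1)); pose b := S1 / m * (1 - alpha).
have c0 : 0 < S1 / m by rewrite divr_gt0.
(* For [m = 1] the guarded bound on [alpha] says nothing, but then [a = S1 / m]. *)
have a0 : 0 <= a.
  rewrite mulr_ge0 ?(ltW c0) //; have [m1|m1] := ltP 1 m.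
    by have := lalpha m1; rewrite ltrNl ltr_pdivlMr ?subr_gt0 //; lra.
  have : m - 1 = 0 by apply/eqP; rewrite eq_le subr_le0 m1 m1E ler0n.
  by move=> ->; rewrite mulr0 addr0.
have ab : a <= b.
  rewrite ler_pM2l //; have : 0 <= m - 1 by rewrite m1E ler0n.
  nra.
pose s := sort >=%R [seq x i | i <- enum 'I_n].
have szs : size s = n by rewrite size_sort size_map size_enum_ord.
have sumE f : \sum_(z <- s) f z = \sum_i f (x i) :> R.
  by rewrite (perm_big _ (permEl (perm_sort _ _))) big_map big_enum.
(* The [m - 1] largest values, the [m]-th, and the rest. *)
have sE : s = take k s ++ nth 0 s k :: drop k.+1 s.
  by rewrite -drop_nth ?szs // cat_take_drop.
have szt : size (take k s) = k by rewrite size_takel // szs ltnW.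
have := @sum_sqr_le_extremal R r a b (nth 0 s k) (take k s) (drop k.+1 s).
rewrite -sE szt !sumE hsum1 hsumr -m1E.
move=> /(_ _ _ r2 a0 ab) S2.
have {}S2 : \sum_i x i ^+ 2 <= (m - 1) * b ^+ 2 + a ^+ 2.
  apply: S2.
  - by rewrite /a /b; field; rewrite gt_eqF.
  (* Scaled by [(S1 / m) ^+ r], the equation for [alpha] says that the extremal point has [r]-th
     power sum [Sr]. *)
  - rewrite /a /b ![(S1 / m * _) ^+ r]exprMn mulrCA -mulrDr addrC alphaE.
    by rewrite expr_div_n; field; rewrite !expf_neq0 ?gt_eqF.
  - by apply: sort_sorted => y z; exact: le_total.
  - by move=> z; rewrite mem_sort => /mapP[i _ ->].
rewrite potential_energyE hsum1.
apply: (@le_trans _ _ (n%:R * ((m - 1) * b ^+ 2 + a ^+ 2) - S1 ^+ 2)).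
  by rewrite lerD2r ler_wpM2l.
(* Equality holds, since [(m - 1) * b ^+ 2 + a ^+ 2 = S1 ^+ 2 / m * (1 + (m - 1) * alpha ^+ 2)]. *)
rewrite le_eqVlt; apply/orP; left; apply/eqP; rewrite /a /b.
by field; rewrite gt_eqF.
Qed.
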